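(* Let $\Gamma$ be an abelian group containing no element of order two. Let $M_1,M_2$ be matroids on a common ground set $E$, $\psi\colon E\to\Gamma$ a labeling, and $B_0$ a common basis of $M_1,M_2$ with $\psi(B_0)=0$. Then $M_1$ and $M_2$ have a common basis $B^*$ with $\psi(B^* )\neq0$ if and only if $D_{M_1,M_2}(B_0)$ contains a directed cycle $C$ with $\psi'(C)\ne 0$.
   Context: $\psi(S):=\sum_{x\in S}\psi(x)$. For a common basis $B$ of $M_1,M_2$, the digraph $D_{M_1,M_2}(B)$ has vertex set $E$ and arcs: for each $x\in B$, $y\in E\setminus B$ with $B-x+y$ a basis of $M_1$, an arc $xy$ with label $\psi'(xy):=\psi(y)$; and for each $x\in B$, $y\in E\setminus B$ with $B-x+y$ a basis of $M_2$, an arc $yx$ with label $\psi'(yx):=-\psi(x)$. The label $\psi'(C)$ of a directed cycle is the sum of the labels of its arcs. *)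

(* Defs.v *)
From mathcomp Require Import all_boot all_order all_algebra.
Set Implicit Arguments. Unset Strict Implicit. Unset Printing Implicit Defensive.
Import GRing.Theory.
Local Open Scope ring_scope.

Definition is_matroid (E : finType) (bases : pred {set E}) : Prop :=
  (exists B, bases B) /\
  (forall B1 B2 x, bases B1 -> bases B2 -> x \in B1 :\: B2 ->
     exists2 y, y \in B2 :\: B1 & bases (y |: (B1 :\ x))).

Definition psi_set (G : zmodType) (E : finType) (psi : E -> G) (S : {set E}) : G :=
  \sum_(x in S) psi x.

Definition exch_arc (E : finType) (M1 M2 : pred {set E}) (B : {set E}) : rel E :=
  fun u v =>
    ((u \in B) && (v \notin B) && M1 (v |: (B :\ u)))
    || ((u \notin B) && (v \in B) && M2 (u |: (B :\ v))).

Definition arc_label (G : zmodType) (E : finType) (psi : E -> G) (B : {set E})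
  (u v : E) : G :=
  if (u \in B) && (v \notin B) then psi v else - psi v.

(* A directed cycle, given as the (nonempty, duplicate-free) cyclic sequence
   of its vertices c = [v_0; ...; v_{k-1}], with arcs v_i -> v_{i+1 mod k}. *)
Definition directed_cycle (E : finType) (e : rel E) (c : seq E) : Prop :=
  [/\ c != [::], uniq c & cycle e c].

(* psi'(C): sum of the labels of the arcs v_i -> v_{i+1 mod k} of the cycle. *)
Definition cycle_label (G : zmodType) (E : finType) (psi : E -> G) (B : {set E})
  (c : seq E) : G :=
  \sum_(p <- zip c (rot 1 c)) arc_label psi B p.1 p.2.

(* Main.v *)
Require Import Defs.
From mathcomp Require Import all_boot all_order all_algebra.
Set Implicit Arguments. Unset Strict Implicit. Unset Printing Implicit Defensive.
Import GRing.Theory.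
Local Open Scope ring_scope.

(** Along exchange arcs the label of an arc depends only on its head, so the
label of a cycle is the sum of fixed weights over its vertices.

For a common basis [Bs], matchings between [B0 \ Bs] and [Bs \ B0] in the two
exchange graphs together form a disjoint union of directed cycles of total
label [psi Bs - psi B0]; hence some cycle has nonzero label.

Conversely let [c] be a shortest cycle with nonzero label [F].  If the arcs of
one of the matroids admitted another perfect matching on the vertices of [c],
superposing it with [c] would give an arc family covering every vertex twice,
of label [2F <> 0].  A chord of [c] in this family closes up to a cycle shorter
than [c], hence of label [0]; at most one cycle in a decomposition of the rest
has the length of [c], and the other ones have label [0], so [2F] is [0] or
[F], a contradiction.  Thus both perfect matchings are unique, and then
exchanging along all of [c] yields a common basis. *)

(** * Decomposing arc families into directed cycles *)

Lemma fun_cycle (T : finType) (s : T -> T) (P : pred T) x :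
  P x -> (forall y, P y -> P (s y)) ->
  exists c, [/\ c != [::], uniq c, fcycle s c & all P c].
Proof.
move=> Px Ps.
have Piter n : P (iter n s x) by elim: n => //= n /Ps.
(* As [s] need not be injective, the orbit of [x] may start with a tail: it returns to its [i]-th
   point, and the cycle is the orbit from there on. *)
have /trajectP[i lti Ei] := looping_order s x.
have Eo : (order s x = i + (order s x - i.+1).+1)%N by rewrite subnSK // subnKC // ltnW.
set m := (order s x - i.+1)%N in Eo.
exists (traject s (iter i s x) m.+1); split => //.
- have := orbit_uniq s x; rewrite /orbit Eo trajectD cat_uniq.
  by case/and3P.
- rewrite trajectS /=.
  have -> : rcons (traject s (s (iter i s x)) m) (iter i s x)
            = traject s (s (iter i s x)) m.+1.
    rewrite [RHS]trajectSr; congr rcons.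
    by rewrite -iterSr -iterD addnC -Eo Ei.
  exact: fpath_traject.
- apply/allP=> y /trajectP[j _ ->]; rewrite -iterD; exact: Piter.
Qed.

Definition arcs (T : Type) (c : seq T) : seq (T * T) := zip c (rot 1 c).

Lemma unzip1_arcs (T : Type) (c : seq T) : unzip1 (arcs c) = c.
Proof. by rewrite unzip1_zip // size_rot. Qed.

Lemma unzip2_arcs (T : Type) (c : seq T) : unzip2 (arcs c) = rot 1 c.
Proof. by rewrite unzip2_zip // size_rot. Qed.

Lemma cycle_arcs (T : Type) (e : rel T) (c : seq T) :
  cycle e c = all (fun p => e p.1 p.2) (arcs c).
Proof.
rewrite /arcs; case: c => // x p /=; rewrite rot1_cons.
move: {2 4}x => y; elim: p x => [|z p IH] x //=.
by rewrite IH.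
Qed.

Lemma perm_uniq_sub (T : eqType) (s1 s2 : seq T) :
  uniq s1 -> {subset s1 <= s2} -> exists s, perm_eq s2 (s1 ++ s).
Proof.
elim: s1 s2 => [|x s1 IH] s2 /=; first by exists s2.
case/andP=> xs1 us1 sub.
have xs2 : x \in s2 by apply: sub; rewrite mem_head.
have [|s Hs] := IH (rem x s2) us1.
  move=> y ys1; have ys2 : y \in s2 by apply: sub; rewrite inE ys1 orbT.
  move: ys2; rewrite (perm_mem (perm_to_rem xs2)) inE.
  by case/orP=> // /eqP yx; move: xs1; rewrite -yx ys1.
by exists s; rewrite (permPl (perm_to_rem xs2)) perm_cons.
Qed.

(** Indegree equals outdegree at every vertex. Families are lists because superposed matchings may
    have parallel arcs, counted with multiplicity. *)
Definition balanced (T : eqType) (A : seq (T * T)) := perm_eq (unzip1 A) (unzip2 A).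

(** The arcs of [c] have distinct tails, so they can be split off [A] as a sublist; this takes the
    vertices of [c] once from the tails and once from the heads. *)
Lemma balanced_remove_cycle (T : eqType) (A : seq (T * T)) (c : seq T) :
  balanced A -> uniq c -> cycle (fun u v => (u, v) \in A) c ->
  exists A', perm_eq A (arcs c ++ A') /\ balanced A'.
Proof.
move=> bA uc; rewrite cycle_arcs => /allP sub.
have uA : uniq (arcs c) by apply: (@map_uniq _ _ fst); rewrite -/(unzip1 _) unzip1_arcs.
have [|A' pA] := @perm_uniq_sub _ (arcs c) A uA; first by case=> u v /sub.
exists A'; split => //; rewrite /balanced.
move: bA; rewrite /balanced (permPl (perm_map fst pA)) (permPr (perm_map snd pA)).
rewrite !map_cat -/(unzip1 _) -/(unzip2 _) -/(unzip1 A') -/(unzip2 A').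
rewrite unzip1_arcs unzip2_arcs.
rewrite (permPr (perm_cat (_ : perm_eq (rot 1 c) c) (perm_refl _))); last by rewrite perm_rot.
by rewrite perm_cat2l.
Qed.

(** Balance makes the head of each arc a tail again, so one can walk until a cycle closes, remove it
    and repeat. Multiplicities are tracked for vertices only, which suffices for weights on
    vertices. *)
Lemma balanced_decomposition (T : finType) (A : seq (T * T)) :
  balanced A ->
  exists2 cs, (forall c, c \in cs -> directed_cycle (fun u v => (u, v) \in A) c)
            & perm_eq (unzip1 A) (flatten cs).
Proof.
have [n] := ubnP (size A); elim: n A => // n IH A ltA bA.
case: A ltA bA => [_ _|[x0 y0] A0]; first by exists [::].
set A := _ :: A0 => ltA bA.
(* [s x] is the head of the first arc leaving [x]; the default [x0] occurs only when no arc leaves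
   [x]. *)
pose s x := nth x0 (unzip2 A) (index x (unzip1 A)).
have sA x : x \in unzip1 A -> (x, s x) \in A.
  move=> xA; have lti : (index x (unzip1 A) < size A)%N.
    by rewrite -[size A](size_map fst) index_mem.
  have -> : (x, s x) = nth (x0, x0) A (index x (unzip1 A)).
    rewrite [RHS]surjective_pairing /s (nth_map (x0, x0)) //; congr pair.
    by rewrite -(@nth_map _ _ _ x0 fst) // nth_index.
  exact: mem_nth.
have [|y yA|c [c0 uc cc /allP Pc]] := @fun_cycle T s [in unzip1 A] x0.
- exact: mem_head.
- change (s y \in unzip1 A); rewrite (perm_mem bA); apply/mapP.
  by exists (y, s y) => //; apply: sA.
have cA : cycle (fun u v => (u, v) \in A) c.
  apply: sub_in_cycle cc; last exact/allP/Pc.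
  by move=> u v uA _ /= /eqP <-; apply: sA.
have [A' [pA bA']] := balanced_remove_cycle bA uc cA.
have [|cs csA pcs] := IH A' _ bA'.
  rewrite -ltnS; apply: leq_trans ltA.
  rewrite (perm_size pA) size_cat ltnS -addn1 addnC leq_add2r.
  by rewrite -(size_map fst) -/(unzip1 _) unzip1_arcs; case: (c) c0.
exists (c :: cs).
- move=> d; rewrite inE => /predU1P[->|/csA[d0 ud cd]]; first by split.
  split=> //; apply: sub_cycle cd => u v uvA'.
  by rewrite (perm_mem pA) mem_cat uvA' orbT.
- rewrite (permPl (perm_map fst pA)) map_cat -/(unzip1 (arcs c)) unzip1_arcs /=.
  by rewrite perm_cat2l.
Qed.

(** * Basis exchange in one matroid *)

Section Matroid.
Variables (E : finType) (M : pred {set E}).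
Hypothesis matM : is_matroid M.

Let exch B1 B2 x : M B1 -> M B2 -> x \in B1 -> x \notin B2 ->
  exists y, [/\ y \in B2, y \notin B1 & M (y |: (B1 :\ x))].
Proof.
move=> M1 M2 x1 x2; case: matM => _ /(_ B1 B2 x M1 M2).
rewrite inE x1 x2 => /(_ isT)[y]; rewrite inE => /andP[y1 y2] My.
by exists y.
Qed.

Let setDU1_ltn (K B : {set E}) z w : z \in K -> z \notin B -> w \in B ->
  (#|(w |: (K :\ z)) :\: B| < #|K :\: B|)%N.
Proof.
move=> zK zB wB; apply: proper_card; apply/properP; split.
  apply/subsetP=> v; rewrite !inE; case: eqP => [->|_]; first by rewrite wB.
  by case/and3P=> -> _ ->.
exists z; first by rewrite !inE zB.
by rewrite !inE eqxx /= orbF negb_and zB /=; apply: contraNneq zB => ->.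
Qed.

(** [Y] is the part outside [B] of the fundamental circuit of [x] over [B']. A basis [K] containing
    [L] misses [x]; if also [K :\: B] lies in [Y], exchanging [x] out of [B] against [K] yields a
    [y] in [Y], as required. *)
Lemma symmetric_exchange B B' x : M B -> M B' -> x \in B -> x \notin B' ->
  exists y, [/\ y \in B', y \notin B, M (y |: (B :\ x)) & M (x |: (B' :\ y))].
Proof.
move=> MB MB' xB xB'.
pose Y := [set y in B' :\: B | M (x |: (B' :\ y))].
pose L := Y :|: (B :&: B').
have LB' : L \subset B'.
  by apply/subsetP=> y; rewrite !inE => /orP[/andP[/andP[]]|/andP[]].
(* [L] spans [x]: a basis through [L + x] could be pushed into [B' + x]. *)
have spanned K : M K -> L \subset K -> x \notin K.
  have [n] := ubnP #|K :\: B'|; elim: n K => // n IH K ltK MK LK.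
  apply/negP=> xK.
  have [/existsP[w /and3P[wK wB' wx]]|/existsPn only_x] :=
    boolP [exists w, [&& w \in K, w \notin B' & w != x]].
    have [u [uB' uK MK']] := exch MK MB' wK wB'.
    have : x \notin u |: (K :\ w).
      apply: (IH _ _ MK').
        by apply: leq_trans (setDU1_ltn wK wB' uB') _; rewrite -ltnS.
      apply/subsetP=> v vL; rewrite !inE (subsetP LK v vL) andbT.
      by rewrite [v == w](contraNF _ wB') ?orbT // => /eqP <-; apply: (subsetP LB').
    by rewrite !inE xK [x == w]eq_sym wx orbT.
  have [y [yB' yK _]] := exch MK MB' xK xB'.
  have [w [wK wB' Mw]] := exch MB' MK yB' yK.
  have wx : w = x by apply/eqP; move: (only_x w); rewrite wK wB' /= negbK.
  have yL : y \in L.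
    by rewrite !inE yB' -wx Mw !andbT /= orNb.
  by move: yK; rewrite (subsetP LK _ yL).
(* Start from [B'] and replace the elements outside [B] and [Y] by elements of [B], one at a time;
   none of those removed lies in [L]. *)
have [K [MK LK KY]] : exists K, [/\ M K, L \subset K & K :\: B \subset Y].
  suff H n K : (#|K :\: B| < n)%N -> M K -> L \subset K ->
      exists K, [/\ M K, L \subset K & K :\: B \subset Y].
    exact: (H #|B' :\: B|.+1 B').
  elim: n K => // n IH K ltK MK LK.
  have [KY|/subsetPn[z]] := boolP (K :\: B \subset Y); first by exists K.
  rewrite inE => /andP[zB zK] zY.
  have [w [wB wK Mw]] := exch MK MB zK zB.
  apply: (IH _ _ Mw).
    by apply: leq_trans (setDU1_ltn zK zB wB) _; rewrite -ltnS.
  apply/subsetP=> v vL; rewrite !inE (subsetP LK v vL) andbT.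
  suff -> : v != z by rewrite orbT.
  apply: contraTneq vL => ->; rewrite inE (negPf zY) inE (negPf zB).
  by [].
have xK := spanned K MK LK.
have [y [yK yB My]] := exch MB MK xB xK.
have : y \in Y by apply: (subsetP KY); rewrite inE yB.
by rewrite !inE => /andP[/andP[_ yB'] My']; exists y.
Qed.

(** Induction moves [B'] towards [B] by symmetric exchanges. Since [B] stays fixed, every recorded
    pair is an exchange in the original [B]. *)
Lemma exchange_matching B B' : M B -> M B' ->
  exists l : seq (E * E),
    [/\ perm_eq (unzip1 l) (enum (B :\: B')), perm_eq (unzip2 l) (enum (B' :\: B))
      & forall p, p \in l -> M (p.2 |: (B :\ p.1))].
Proof.
have [n] := ubnP #|B :\: B'|; elim: n B' => // n IH B' ltB MB MB'.
have [D0|[x]] := set_0Vmem (B :\: B').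
  exists [::]; split => //=; first by rewrite D0 enum_set0.
  suff -> : B' :\: B = set0 by rewrite enum_set0.
  apply/setP=> y; rewrite in_set0; apply/negP; rewrite inE => /andP[yB yB'].
  have [z [zB zB' _]] := exch MB' MB yB' yB.
  by move/setP/(_ z): D0; rewrite !inE zB zB'.
rewrite inE => /andP[xB' xB].
have [y [yB' yB My My']] := symmetric_exchange MB MB' xB xB'.
have yx : y != x by apply: contraNneq yB => ->.
have D1 : B :\: B' = x |: (B :\: (x |: (B' :\ y))).
  apply/setP=> v; rewrite !inE; case: (eqVneq v x) => [->|_] /=; first by rewrite xB' xB.
  by case: (eqVneq v y) => [->|_] //=; rewrite yB' (negPf yB).
have D2 : B' :\: B = y |: ((x |: (B' :\ y)) :\: B).
  apply/setP=> v; rewrite !inE; case: (eqVneq v y) => [->|_] /=; first by rewrite yB' yB.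
  by case: (eqVneq v x) => [->|_] //=; rewrite xB.
have [|l [l1 l2 lM]] := IH (x |: (B' :\ y)) _ MB My'.
  by move: ltB; rewrite D1 cardsU1 !inE eqxx /= add1n ltnS.
exists ((x, y) :: l); split => /=.
- rewrite D1; apply: uniq_perm; rewrite /= ?enum_uniq ?(perm_uniq l1) ?enum_uniq //.
    by rewrite (perm_mem l1) mem_enum !inE eqxx.
  by move=> v; rewrite inE (perm_mem l1) !mem_enum in_setU1.
- rewrite D2; apply: uniq_perm; rewrite /= ?enum_uniq ?(perm_uniq l2) ?enum_uniq //.
    by rewrite (perm_mem l2) mem_enum !inE eqxx (negPf yx) andbF.
  by move=> v; rewrite inE (perm_mem l2) !mem_enum in_setU1.
- by move=> p; rewrite inE => /predU1P[->|/lM].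
Qed.

(** In each direction one exchange leaves only two candidates for the incoming element, and the
    wrong one would make [y' |: (B :\ x)] a basis. Thus swapping [x] for [y] preserves the exchange
    arcs at heads that [x] does not reach. *)
Lemma exchange_edge B x y x' y' :
  M B -> M (y |: (B :\ x)) -> ~~ M (y' |: (B :\ x)) ->
  x \in B -> x' \in B -> x != x' -> y \notin B -> y' \notin B -> y != y' ->
  M (y' |: ((y |: (B :\ x)) :\ x')) = M (y' |: (B :\ x')).
Proof.
move=> MB My nMy' xB x'B xx' yB y'B yy'.
have [yx yx' y'x y'x'] : [/\ y != x, y != x', y' != x & y' != x'].
  by split; [move: yB | move: yB | move: y'B | move: y'B]; apply: contraNneq => ->.
have sym := (eq_sym x' x, eq_sym x y, eq_sym x' y, eq_sym x y', eq_sym x' y', eq_sym y' y).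
have ne := (negPf xx', negPf yy', negPf yx, negPf yx', negPf y'x, negPf y'x').
have mem := (xB, x'B, negPf yB, negPf y'B).
have set_eq (A1 A2 : {set E}) : x \in A1 = (x \in A2) -> x' \in A1 = (x' \in A2) ->
    y \in A1 = (y \in A2) -> y' \in A1 = (y' \in A2) ->
    (forall v, v != x -> v != x' -> v != y -> v != y' -> v \in A1 = (v \in A2)) -> A1 = A2.
  move=> e1 e2 e3 e4 e5; apply/setP=> v.
  have [->//|vx] := eqVneq v x; have [->//|vx'] := eqVneq v x'.
  by have [->//|vy] := eqVneq v y; have [->//|vy'] := eqVneq v y'; apply: e5.
have xy_x'y' : y' |: (B :\ x) = x' |: ((y' |: (B :\ x')) :\ x).
  apply: set_eq; rewrite ?inE ?sym ?eqxx ?ne ?mem ?eqxx //= => v /negPf vx /negPf vx' /negPf vy /negPf vy'.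
  by rewrite !inE vx vx' vy'.
apply/idP/idP => MH.
- have [||z [zB zH Mz]] := exch MH MB (x := y); rewrite ?inE ?sym ?eqxx ?ne ?mem //.
  have : (z == x) || (z == x').
    by move: zH; rewrite !inE zB; case: (z == x); case: (z == x'); rewrite //= ?orbT.
  case/orP=> /eqP Ez; move: Mz; rewrite Ez.
    congr (is_true (M _)); apply: set_eq; rewrite ?inE ?sym ?eqxx ?ne ?mem ?eqxx //=.
    by move=> v /negPf vx /negPf vx' /negPf vy /negPf vy'; rewrite !inE vx vx' vy vy'.
  have -> : x' |: (y' |: (y |: B :\ x) :\ x') :\ y = y' |: (B :\ x).
    apply: set_eq; rewrite ?inE ?sym ?eqxx ?ne ?mem ?eqxx //=.
    by move=> v /negPf vx /negPf vx' /negPf vy /negPf vy'; rewrite !inE vx vx' vy vy'.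
  by rewrite (negPf nMy').
- have [||z [zB zH Mz]] := exch MH My (x := x); rewrite ?inE ?sym ?eqxx ?ne ?mem //.
  have : (z == y) || (z == x').
    by move: zB zH; rewrite !inE; case: (z == y) => //=; case: (z == x') => //= /andP[_ ->]; rewrite orbT.
  case/orP=> /eqP Ez; move: Mz; rewrite Ez.
    congr (is_true (M _)); apply: set_eq; rewrite ?inE ?sym ?eqxx ?ne ?mem ?eqxx //=.
    by move=> v /negPf vx /negPf vx' /negPf vy /negPf vy'; rewrite !inE vx vx' vy vy'.
  by rewrite -xy_x'y' (negPf nMy').
Qed.

(** An acyclic digraph on [X] has a sink [x]. Exchange [x] for [N x] first: by [exchange_edge] the
    digraph on the rest of [X] is unchanged, so induction applies to the new basis. *)
Lemma acyclic_matching_basis (B X : {set E}) (N : E -> E) :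
  M B -> X \subset B -> {in X &, injective N} ->
  (forall x, x \in X -> N x \notin B) ->
  (forall x, x \in X -> M (N x |: (B :\ x))) ->
  (forall d, ~ directed_cycle (fun x x' =>
       [&& x \in X, x' \in X, x != x' & M (N x' |: (B :\ x))]) d) ->
  M ((B :\: X) :|: N @: X).
Proof.
have [n] := ubnP #|X|; elim: n B X => // n IH B X ltX MB XB injN NB MN acyc.
have [->|[x0 x0X]] := set_0Vmem X; first by rewrite setD0 imset0 setU0.
have [x xX sink] : exists2 x, x \in X & forall x', x' \in X -> x != x' -> ~~ M (N x' |: (B :\ x)).
  have [/existsP[x /andP[xX /forallP H]]|/existsPn noSink] :=
    boolP [exists x, (x \in X) && [forall x', (x' \in X) ==> (x != x') ==> ~~ M (N x' |: (B :\ x))]].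
    by exists x => // x' x'X xx'; have := H x'; rewrite x'X xx'.
  exfalso.
  (* Without a sink every vertex of [X] has an out-neighbour; iterating such a choice produces a
     forbidden cycle. *)
  pose s x := odflt x [pick x' | [&& x \in X, x' \in X, x != x' & M (N x' |: (B :\ x))]].
  have sP x : x \in X -> [&& x \in X, s x \in X, x != s x & M (N (s x) |: (B :\ x))].
    move=> xX; rewrite /s; case: pickP => [x' -> //|none].
    have := noSink x; rewrite xX /= => /forallPn[x'].
    by have := none x'; rewrite xX /=; case: (x' \in X); case: (x != x') => //= ->.
  have [//||d [d0 ud cd /allP dX]] := @fun_cycle E s [in X] x0.
    by move=> y /sP /and4P[].
  apply: (acyc d); split=> //.
  apply: sub_in_cycle cd; last exact/allP/dX.
  by move=> u v uX _ /= /eqP <-; apply: sP.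
have xB := subsetP XB _ xX.
have edge x' z : x' \in X :\ x -> z \in X :\ x ->
    M (N z |: ((N x |: (B :\ x)) :\ x')) = M (N z |: (B :\ x')).
  rewrite !inE => /andP[x'x x'X] /andP[zx zX].
  apply: exchange_edge; rewrite ?MN ?NB ?sink 1?eq_sym ?(subsetP XB) //.
  by apply: contraNneq zx => /injN ->.
have -> : B :\: X :|: N @: X = (N x |: (B :\ x)) :\: (X :\ x) :|: N @: (X :\ x).
  have NX : N x \notin X by apply: contra (NB x xX); apply: subsetP.
  rewrite -{2}(setD1K xX) imsetU1; apply/setP=> v; rewrite !inE.
  have [->|_] := eqVneq v (N x); first by rewrite (negPf NX) andbF orbT.
  have [->|_] := eqVneq v x; first by rewrite xX.
  by [].
apply: IH.
- by move: ltX; rewrite (cardsD1 x) xX add1n ltnS.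
- exact: MN.
- apply/subsetP=> v; rewrite !inE => /andP[-> vX].
  by rewrite (subsetP XB) ?orbT.
- by move=> u v; rewrite !inE => /andP[_ uX] /andP[_ vX]; apply: injN.
- move=> v; rewrite !inE => /andP[vx vX].
  rewrite negb_or negb_and NB ?orbT ?andbT //.
  by apply: contraNneq vx => /injN ->.
- move=> v vX; rewrite edge //; apply: MN.
  by move: vX; rewrite !inE => /andP[].
- move=> d [d0 ud cd]; apply: (acyc d); split => //.
  apply: sub_cycle cd => u v /and4P[uX vX uv].
  rewrite edge // => Mv; move: uX vX; rewrite !inE => /andP[_ ->] /andP[_ ->].
  by rewrite uv.
Qed.
End Matroid.

(** * Rigidity of a shortest cycle with nonzero label *)

Lemma shortest_cycle_rigid (G : zmodType) (E : finType) (e : rel E) (g : E -> G)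
    (c : seq E) (tau : E -> E) :
  (forall h : G, h + h = 0 -> h = 0) -> irreflexive e ->
  directed_cycle e c -> \sum_(v <- c) g v != 0 ->
  (forall d, directed_cycle e d -> (size d < size c)%N -> \sum_(v <- d) g v = 0) ->
  perm_eq (map tau c) c -> {in c, forall v, e v (tau v)} ->
  {in c, forall v, tau v = next c v}.
Proof.
move=> tor irr [_ uc cc] Fn0 minc ptau etau x xc; apply/eqP/negPn/negP=> tau_x.
set F := \sum_(v <- c) g v in Fn0.
pose A := arcs c ++ [seq (v, tau v) | v <- c].
have un1 : unzip1 [seq (v, tau v) | v <- c] = c by rewrite /unzip1 -map_comp map_id.
have un2 : unzip2 [seq (v, tau v) | v <- c] = map tau c by rewrite /unzip2 -map_comp.
have bA : balanced A.
  rewrite /balanced /unzip1 /unzip2 !map_cat -!/(unzip1 _) -!/(unzip2 _).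
  rewrite unzip1_arcs unzip2_arcs un1 un2; apply: perm_cat; rewrite perm_sym //.
  by rewrite perm_rot.
have nextA u : u \in c -> (u, next c u) \in A.
  move=> uc'; suff cA : cycle (fun u v => (u, v) \in A) c by exact: (next_cycle cA uc').
  by rewrite cycle_arcs; apply/allP=> -[v w] vw; rewrite mem_cat vw.
have tauA u : u \in c -> (u, tau u) \in A.
  by move=> uc'; rewrite mem_cat (map_f (fun v => (v, tau v))) ?orbT.
have Ae u v : (u, v) \in A -> [&& u \in c, v \in c & e u v].
  rewrite mem_cat => /orP[|/mapP[w wc [-> ->]]]; last first.
    by rewrite wc etau // andbT -(perm_mem ptau) map_f.
  suff : cycle (fun u v => [&& u \in c, v \in c & e u v]) c.
    by rewrite cycle_arcs => /allP H /H.
  apply: (sub_in_cycle (P := [in c])) cc; last exact/allP.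
  by move=> w z /= -> ->.
(* The shortcut along [tau] at [x] closes up to a strictly shorter cycle. *)
have [c1 [c1_cyc xc1 lt_c1]] : exists c1,
    [/\ directed_cycle (fun u v => (u, v) \in A) c1, x \in c1 & (size c1 < size c)%N].
  have [i p Ec] := rot_to xc.
  have tx : tau x \in x :: p.
    by rewrite -Ec mem_rot -(perm_mem ptau) map_f.
  have txx : tau x != x by apply: contraTneq (etau x xc) => ->; rewrite irr.
  move: tx; rewrite inE (negPf txx) /= => txp.
  have nx : next c x = next (x :: p) x by rewrite -Ec next_rot.
  have uxp : uniq (x :: p) by rewrite -Ec rot_uniq.
  have cA : cycle (fun u v => (u, v) \in A) (x :: p).
    rewrite -Ec rot_cycle; apply: cycle_from_next => // u uc'; exact: nextA.
  case/splitPr: txp Ec nx uxp cA => p1 p2 Ec nx uxp cA.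
  (* The shortcut from [x] to [tau x] skips [p1], which is nonempty exactly because [tau x] is not
     the successor of [x]. *)
  have p1n : p1 != [::].
    by apply: contraNneq tau_x => p10; rewrite nx p10 /= eqxx.
  exists (x :: tau x :: p2); split; last first.
  - rewrite -(size_rot i c) Ec /= size_cat /= !ltnS.
    by case: (p1) p1n => //= ? ? _; rewrite addSn ltnS leq_addl.
  - exact: mem_head.
  split=> //.
    move: uxp; rewrite /= mem_cat !inE cat_uniq /= !negb_or.
    by case/and3P=> /and3P[_ -> ->] _ /and3P[_ -> ->].
  move: cA; rewrite /= rcons_cat cat_path /= tauA //.
  by case/and3P.
have c1_e : directed_cycle e c1.
  case: c1_cyc => n1 u1 cy1; split => //.
  by apply: sub_cycle cy1 => u v /Ae/and3P[].
have [_ uc1 cA1] := c1_cyc.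
have [A' [pA bA']] := balanced_remove_cycle bA uc1 cA1.
have [cs csA pcs] := balanced_decomposition bA'.
have pc2 : perm_eq (c ++ c) (c1 ++ flatten cs).
  have := perm_map fst pA; rewrite !map_cat -!/(unzip1 _) !unzip1_arcs un1 => /permPl ->.
  by rewrite perm_cat2l.
have csP d : d \in cs -> directed_cycle e d /\ {subset d <= c}.
  move=> /csA[d0 ud cd]; split.
    split=> //; apply: sub_cycle cd => u v uvA'.
    by have /Ae/and3P[] : (u, v) \in A by rewrite (perm_mem pA) mem_cat uvA' orbT.
  move=> v vd; have := next_cycle cd vd => uvA'.
  by have /Ae/and3P[] : (v, next d v) \in A by rewrite (perm_mem pA) mem_cat uvA' orbT.
have sum2 : F + F = \sum_(d <- cs) \sum_(v <- d) g v.
  rewrite /F -big_cat /= (perm_big _ pc2) big_cat /= (minc _ c1_e lt_c1) add0r.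
  exact: big_flatten.
(* A cycle inside [c] is either shorter than [c], hence of label [0], or runs through all its
   vertices, hence of label [F]. *)
pose full (d : seq E) := size d == size c.
have sum_d d : d \in cs -> \sum_(v <- d) g v = if full d then F else 0.
  move=> dcs; have [d_e sub] := csP d dcs; have [_ ud _] := d_e.
  have le := uniq_leq_size ud sub.
  case: ifP => [/eqP sz|nf]; last first.
    by apply: minc => //; rewrite ltn_neqAle le andbT; apply/negbT.
  apply: perm_big; apply: uniq_perm => //.
  by have [|_ //] := uniq_min_size ud sub; rewrite sz.
(* [x] occurs twice in [c ++ c] and once in [c1], hence once in the cycles of [cs], whereas every
   full cycle contains it. *)
have full_le1 : (count full cs <= 1)%N.
  have := permP pc2 (pred1 x); rewrite !count_cat.
  rewrite (count_uniq_mem x uc) (count_uniq_mem x uc1) xc xc1 => /addnI /= Ex.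
  rewrite Ex count_flatten sumnE big_map -sum1_count big_mkcond /=.
  rewrite [X in (_ <= X)%N]big_seq [X in (X <= _)%N]big_seq.
  apply: leq_sum => d dcs; case: ifP => // /eqP sz.
  have [[_ ud _] sub] := csP d dcs.
  have [|_ eqdc] := uniq_min_size ud sub; first by rewrite sz.
  by rewrite count_uniq_mem // eqdc xc.
have : F + F = F *+ count full cs.
  rewrite sum2 big_seq (eq_bigr _ sum_d) -big_seq -big_mkcond /= big_const_seq.
  by rewrite iter_addr_0.
move: full_le1; case: (count full cs) => [|[|//]] _.
  by move=> /tor F0; rewrite F0 eqxx in Fn0.
by move=> /(congr1 (fun h => h - F)); rewrite addrK mulr1n subrr => F0; rewrite F0 eqxx in Fn0.
Qed.

(** * Vertex weights and exchanging along a shortest cycle *)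

Definition arc_weight (G : zmodType) (E : finType) (psi : E -> G) (B : {set E}) (v : E) : G :=
  if v \in B then - psi v else psi v.

Lemma cycle_labelE (G : zmodType) (E : finType) (M1 M2 : pred {set E}) (psi : E -> G)
    (B : {set E}) (c : seq E) :
  cycle (exch_arc M1 M2 B) c ->
  cycle_label psi B c = \sum_(v <- c) arc_weight psi B v.
Proof.
rewrite cycle_arcs => /allP arcP.
have -> : \sum_(v <- c) arc_weight psi B v = \sum_(p <- arcs c) arc_weight psi B p.2.
  rewrite -(big_map snd predT) -/(unzip2 _) unzip2_arcs.
  by apply: perm_big; rewrite perm_sym perm_rot.
rewrite /cycle_label -/(arcs c) big_seq [RHS]big_seq; apply: eq_bigr => -[u v] /arcP /=.
by rewrite /exch_arc /arc_label /arc_weight; case: (u \in B); case: (v \in B).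
Qed.

(** Swapping the matroids reverses all arcs; this reduces the claim for [M2] to the one for [M1] on
    the reversed cycle. *)
Lemma exch_arc_sym (E : finType) (M1 M2 : pred {set E}) (B : {set E}) u v :
  exch_arc M1 M2 B u v = exch_arc M2 M1 B v u.
Proof.
by rewrite /exch_arc orbC [(u \in B) && _]andbC [(u \notin B) && _]andbC.
Qed.

(** Elements of [S] in [B] are lost and the others gained, so the sum of the weights over a cycle is
    the change of [psi_set] under exchanging along it. *)
Lemma psi_set_symdiff (G : zmodType) (E : finType) (psi : E -> G) (B S : {set E}) :
  psi_set psi ((B :\: S) :|: (S :\: B)) =
  psi_set psi B + \sum_(v in S) arc_weight psi B v.
Proof.
rewrite /psi_set (big_mkcond [in S]) (big_mkcond [in B]) -big_split big_mkcond /=.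
apply: eq_bigr => v _; rewrite !inE /arc_weight.
by case: (v \in B); case: (v \in S); rewrite /= ?subrr ?addr0 ?add0r.
Qed.

(** The arcs of [c] leaving [B] form a matching of [M1] given by [next c]. A cycle in its auxiliary
    digraph would give a second matching, so [acyclic_matching_basis] applies. *)
Lemma shortest_cycle_basis (G : zmodType) (E : finType) (M1 M2 : pred {set E})
    (B : {set E}) (g : E -> G) (c : seq E) :
  (forall h : G, h + h = 0 -> h = 0) -> is_matroid M1 -> M1 B ->
  directed_cycle (exch_arc M1 M2 B) c -> \sum_(v <- c) g v != 0 ->
  (forall d, directed_cycle (exch_arc M1 M2 B) d -> (size d < size c)%N ->
     \sum_(v <- d) g v = 0) ->
  M1 ((B :\: [set v in c]) :|: ([set v in c] :\: B)).
Proof.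
move=> tor matM MB c_cyc Fn0 minc.
have [_ uc cc] := c_cyc.
have irr : irreflexive (exch_arc M1 M2 B).
  by move=> v; rewrite /exch_arc; case: (v \in B).
have arc_next v : v \in c -> exch_arc M1 M2 B v (next c v) by apply: next_cycle.
pose X := B :&: [set v in c].
have XP x : (x \in X) = (x \in B) && (x \in c) by rewrite !inE.
have injn : injective (next c) by apply: can_inj (prev_next uc).
have NX x : x \in X -> next c x \notin B /\ M1 (next c x |: (B :\ x)).
  rewrite XP => /andP[xB xc]; have := arc_next x xc; rewrite /exch_arc xB /=.
  by rewrite orbF => /andP[].
have -> : (B :\: [set v in c]) :|: ([set v in c] :\: B) = (B :\: X) :|: (next c @: X).
  have E1 : [set v in c] :\: B = next c @: X.
    apply/setP=> v; rewrite !inE; apply/andP/imsetP => [[vB vc]|[x xX ->]].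
      exists (prev c v); last by rewrite next_prev.
      have pc : prev c v \in c by rewrite mem_prev.
      rewrite XP pc andbT; have := arc_next _ pc; rewrite next_prev // /exch_arc (negPf vB).
      by rewrite andbF orbF => /andP[/andP[]].
    by have [-> _] := NX x xX; move: xX; rewrite XP mem_next => /andP[].
  by rewrite E1 /X setDIr setDv set0U.
apply: acyclic_matching_basis => //.
- exact: subsetIl.
- by move=> u v _ _; apply: injn.
- by move=> x /NX[].
- by move=> x /NX[].
move=> d [d0 ud cd].
have dX x : x \in d -> [&& x \in X, next d x \in X, x != next d x
    & M1 (next c (next d x) |: (B :\ x))].
  by move=> xd; have := next_cycle cd xd.
(* Shifting the matching along [d] permutes [c], against rigidity. *)
pose tau v := next c (if v \in d then next d v else v).
have ptau : perm_eq (map tau c) c.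
  have tinj : injective tau.
    move=> u v /injn; case: ifP => ud'; case: ifP => vd' // uv.
    - by apply: can_inj (prev_next ud) _ _ uv.
    - by move: vd'; rewrite -uv mem_next ud'.
    - by move: ud'; rewrite uv mem_next vd'.
  have um : uniq (map tau c) by rewrite map_inj_uniq.
  apply: uniq_perm => //.
  have sub : {subset map tau c <= c}.
    move=> _ /mapP[v vc ->]; rewrite mem_next; case: ifP => // vd.
    by have /and4P[_ + _ _] := dX v vd; rewrite XP => /andP[].
  by have [|_ //] := uniq_min_size um sub; rewrite size_map.
have etau : {in c, forall v, exch_arc M1 M2 B v (tau v)}.
  move=> v vc; rewrite /tau; case: ifP => vd; last exact: arc_next.
  have /and4P[vX nX _ Mv] := dX v vd; have [nB _] := NX _ nX.
  by move: vX; rewrite /exch_arc XP nB Mv => /andP[->].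
have rigid := shortest_cycle_rigid tor irr c_cyc Fn0 minc ptau etau.
(* At a vertex [x] of [d], rigidity and injectivity of [next c] force [next d x = x], but the
   auxiliary digraph has no loops. *)
case: d d0 {cd ud} dX @tau ptau etau rigid => // x d _ dX tau _ _ rigid.
have /and4P[xX _ xn _] := dX x (mem_head _ _).
have := rigid x; rewrite /tau mem_head => H.
by case/eqP: xn; apply/esym/injn/H; move: xX; rewrite XP => /andP[].
Qed.

(** * The equivalence *)

Theorem theorem3p8 (G : zmodType) (E : finType) (M1 M2 : pred {set E})
  (psi : E -> G) (B0 : {set E}) :
  (forall g : G, g + g = 0 -> g = 0) ->
  is_matroid M1 -> is_matroid M2 ->
  M1 B0 -> M2 B0 -> psi_set psi B0 = 0 ->
  (exists Bs : {set E}, [/\ M1 Bs, M2 Bs & psi_set psi Bs != 0]) <->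
  (exists c : seq E, directed_cycle (exch_arc M1 M2 B0) c /\
                     cycle_label psi B0 c != 0).
Proof.
move=> tor mat1 mat2 MB1 MB2 psi0.
pose g := arc_weight psi B0.
split=> [[Bs [Ms1 Ms2 psis]]|].
- have [l1 [l11 l12 l1M]] := exchange_matching mat1 MB1 Ms1.
  have [l2 [l21 l22 l2M]] := exchange_matching mat2 MB2 Ms2.
  (* Arcs of [M2] run from outside [B0] into [B0], so the second matching is reversed. Each vertex
     of [S] is then the tail of one arc and the head of one. *)
  pose A := l1 ++ [seq (p.2, p.1) | p <- l2].
  have A1 : unzip1 A = unzip1 l1 ++ unzip2 l2 by rewrite /unzip1 map_cat -map_comp.
  have A2 : unzip2 A = unzip2 l1 ++ unzip1 l2 by rewrite /unzip2 map_cat -map_comp.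
  pose S := (B0 :\: Bs) :|: (Bs :\: B0).
  have A1S : perm_eq (unzip1 A) (enum S).
    rewrite A1 (permPl (perm_cat l11 l22)); apply: uniq_perm; rewrite ?enum_uniq //.
      rewrite cat_uniq !enum_uniq andbT /=; apply/hasPn=> v; rewrite !mem_enum !inE.
      by case: (v \in B0); rewrite ?andbF.
    by move=> v; rewrite mem_cat !mem_enum !inE.
  have A2S : perm_eq (unzip2 A) (enum S).
    rewrite A2 (permPl (perm_cat l12 l21)); apply: uniq_perm; rewrite ?enum_uniq //.
      rewrite cat_uniq !enum_uniq andbT /=; apply/hasPn=> v; rewrite !mem_enum !inE.
      by case: (v \in Bs); rewrite ?andbF.
    by move=> v; rewrite mem_cat !mem_enum !inE orbC.
  have bA : balanced A by rewrite /balanced (permPl A1S) perm_sym.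
  have Ae u v : (u, v) \in A -> exch_arc M1 M2 B0 u v.
    rewrite mem_cat /exch_arc => /orP[uv|/mapP[[x y] xy /= [-> ->]]].
      have := map_f fst uv; rewrite (perm_mem l11) mem_enum inE => /andP[_ /= ->].
      have := map_f snd uv; rewrite (perm_mem l12) mem_enum inE => /andP[/= -> _].
      by rewrite (l1M _ uv).
    have := map_f fst xy; rewrite (perm_mem l21) mem_enum inE => /andP[_ /= ->].
    have := map_f snd xy; rewrite (perm_mem l22) mem_enum inE => /andP[/= -> _].
    by rewrite (l2M _ xy) orbT.
  have [cs csA pcs] := balanced_decomposition bA.
  have sumS : \sum_(c <- cs) \sum_(v <- c) g v != 0.
    rewrite -big_flatten -(perm_big _ pcs) (perm_big _ A1S) big_enum /=.
    have -> : \sum_(v in S) g v = psi_set psi Bs; last by [].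
    have := psi_set_symdiff psi B0 S; rewrite psi0 add0r => <-; congr psi_set.
    by apply/setP=> v; rewrite !inE; case: (v \in B0); case: (v \in Bs).
  have [/hasP[c ccs cn0]|/hasPn none] := boolP (has (fun c => \sum_(v <- c) g v != 0) cs).
    have [c0 uc cc] := csA c ccs.
    have ce : cycle (exch_arc M1 M2 B0) c by apply: sub_cycle cc => u v /Ae.
    by exists c; split=> //; rewrite (cycle_labelE psi ce).
  case/negP: sumS; apply/eqP; rewrite big_seq big1 // => c /none.
  by rewrite negbK => /eqP.
case=> c [].
have [n] := ubnP (size c); elim: n c => // n IH c ltc c_cyc.
have [c0 uc cc] := c_cyc; rewrite (cycle_labelE psi cc) => Fn0.
have [[d [d_cyc ltd dn0]]|minc] :
    (exists d, [/\ directed_cycle (exch_arc M1 M2 B0) d, (size d < size c)%N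
       & \sum_(v <- d) g v != 0]) \/
    (forall d, directed_cycle (exch_arc M1 M2 B0) d -> (size d < size c)%N ->
     \sum_(v <- d) g v = 0).
  (* Tuples of length below [size c] form finite types, which makes the existence of a shorter cycle
     of nonzero label decidable. *)
  have [/existsP[k /existsP[t /and4P[t0 ut ct tn0]]]|none] := boolP [exists k : 'I_(size c),
      exists t : k.-tuple E,
      [&& tval t != [::], uniq t, cycle (exch_arc M1 M2 B0) t & \sum_(v <- t) g v != 0]].
    by left; exists t; rewrite size_tuple.
  right=> d [d0 ud cd] ltd; apply/eqP/negPn/negP=> dn0; case/negP: none.
  apply/existsP; exists (Ordinal ltd); apply/existsP; exists (in_tuple d).
  exact/and4P.
- have [_ _ cd] := d_cyc.
  apply: (IH d) => //; first exact: leq_trans ltd _.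
  by rewrite (cycle_labelE psi cd).
exists ((B0 :\: [set v in c]) :|: ([set v in c] :\: B0)); split.
- exact: (shortest_cycle_basis tor mat1 MB1 c_cyc Fn0 minc).
(* Reversing cycles keeps their lengths and vertex weights, so [rev c] is again shortest with the
   matroids swapped. *)
- have revP d : directed_cycle (exch_arc M1 M2 B0) (rev d) <-> directed_cycle (exch_arc M2 M1 B0) d.
    have cycE : cycle (exch_arc M1 M2 B0) (rev d) = cycle (exch_arc M2 M1 B0) d.
      by rewrite rev_cycle; apply: eq_cycle => u v; rewrite exch_arc_sym.
    by rewrite /directed_cycle cycE rev_uniq -!size_eq0 size_rev.
  have -> : [set v in c] = [set v in rev c] by apply/setP=> v; rewrite !inE mem_rev.
  have sum_rev d : \sum_(v <- rev d) g v = \sum_(v <- d) g v.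
    by apply: perm_big; rewrite perm_rev.
  apply: (shortest_cycle_basis tor mat2 MB2 (M2 := M1) (g := g)).
  + by apply/revP; rewrite revK.
  + by rewrite sum_rev.
  + move=> d /revP d_cyc; rewrite size_rev -size_rev -sum_rev; exact: minc.
rewrite psi_set_symdiff psi0 add0r; congr (_ != 0): Fn0.
rewrite -big_enum; apply: perm_big; apply: uniq_perm; rewrite ?enum_uniq //.
by move=> v; rewrite mem_enum inE.
Qed.
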